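(* Let $A\in\mathbb M_m$ be a Perron-like matrix with principal eigenvalue $s=s(A)$, let $\delta>0$ be such that $\mathrm{Re}\,\mu\le s-2\delta$ for all $\mu\in\sigma(A)\setminus\{s\}$, and let $V=[v_i]_{i\in J}\in\mathbb M_m$ be nonsingular with $\|V\|=1$. For $n\in\mathbb N$ let $T_n=\sum_{k=0}^n\frac1{k!}A^k$, and define $$M_n(0)=V,\qquad M_n(k+1)=\frac{T_nM_n(k)}{\|T_nM_n(k)\|}\quad(k\in\mathbb N).$$ Let $W_n=M_n(n)$, $\lambda=2e^{2\|A\|}$, $y_i=\Pi_1v_i$ and $Y=[y_i]_{i\in J}$. Assume that $s$ is semisimple. Then there exist positive constants $B_1,B_2$ such that, for $n\in\mathbb N$, $$\left\|W_n-\frac{Y}{\|Y\|}\right\|\le B_1e^{-\delta n}+\left(\frac{\lambda\|A\|}{n+1}\right)^{n+1}o(1)$$ and $$\left|\langle AW_n,W_n\rangle-s\right|\le B_2e^{-\delta n}+\|A\|\left(\frac{\lambda\|A\|}{n+1}\right)^{n+1}o(1),$$ where $o(1)$ is an infinitesimal as $n\to\infty$ depending only upon $n$.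
   Context: $J=\{1,\dots,m\}$; $\mathbb N$ is the set of nonnegative integers. $\mathbb M_m$ is the space of real $m\times m$ matrices; $[\alpha_i]_{i\in J}$ denotes the matrix with columns $\alpha_i$. $\mathbb R^m$ carries the Euclidean inner product and norm; on $\mathbb M_m$, $\langle[\alpha_i],[\beta_i]\rangle=\sum_{i\in J}\langle\alpha_i,\beta_i\rangle$ and $\|M\|=\langle M,M\rangle^{1/2}$. $\sigma(A)$ is the set of (complex) eigenvalues of $A$, $s(A)=\max\{\mathrm{Re}\,\mu:\mu\in\sigma(A)\}$. $A$ is Perron-like if $s:=s(A)\in\sigma(A)$ and $\mathrm{Re}\,\mu<s$ for all $\mu\in\sigma(A)\setminus\{s\}$; $s$ is then called the principal eigenvalue. $\mathrm{E}_s(A)=\ker(A-sI)$; $\mathrm{GE}_s(A)=\{\xi\in\mathbb R^m:(A-sI)^k\xi=0\text{ for some }k\ge1\}$; $s$ is semisimple if $\mathrm{GE}_s(A)=\mathrm{E}_s(A)$. For any $\mu\in\sigma(A)$, $\mathrm{GE}_\mu(A)\subset\mathbb R^m$ is the set of all real and imaginary parts of vectors $u\in\mathbb C^m$ with $(A-\mu I)^ku=0$ for some $k\ge1$. Then $\mathbb R^m=E_1\oplus E_2$ with $E_1=\mathrm{GE}_s(A)$, $E_2=\sum_{\mu\in\sigma(A)\setminus\{s\}}\mathrm{GE}_\mu(A)$, and $\Pi_1$ is the projection onto $E_1$ along $E_2$. *)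

(* Defs.v *)
From HB Require Import structures.
From mathcomp Require Import all_boot all_order all_algebra.
From mathcomp Require Import all_classical all_reals all_analysis.
From mathcomp Require Import complex.

Set Implicit Arguments.
Unset Strict Implicit.
Unset Printing Implicit Defensive.

Import Order.TTheory GRing.Theory Num.Theory.
Import numFieldNormedType.Exports.

Local Open Scope classical_set_scope.
Local Open Scope complex_scope.
Local Open Scope ring_scope.

Section MatrixInnerProduct.
Context {R : realType} {m : nat}.
Implicit Types (u v : 'cV[R]_m) (M N : 'M[R]_m).

Definition dotv u v : R := \sum_(i < m) u i 0 * v i 0.

Definition dotM M N : R := \sum_(i < m) dotv (col i M) (col i N).

(* The canonical norm of MathComp-Analysis on matrices is the max norm, hence
   this separate definition of the Euclidean one. *)
Definition normM M : R := Num.sqrt (dotM M M).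

End MatrixInnerProduct.

Section Spectrum.
Context {R : realType} {m : nat}.
Implicit Types (A : 'M[R]_m) (mu : R[i]) (s : R) (x : 'cV[R]_m).

Definition complexify A : 'M[R[i]]_m := map_mx (fun a : R => a%:C) A.

(* [eigenvalue] is defined with row eigenvectors; a square matrix has the same
   eigenvalues for row and for column eigenvectors. *)
Definition spectrum A : set R[i] := [set mu | eigenvalue (complexify A) mu].

(* The spectrum is finite, and nonempty for 0 < m, so that this supremum is a
   maximum. *)
Definition spectral_bound A : R := sup [set complex.Re mu | mu in spectrum A].

Definition perron_like A : Prop :=
  spectrum A (spectral_bound A)%:C /\
  forall mu, spectrum A mu -> mu != (spectral_bound A)%:C ->
    complex.Re mu < spectral_bound A.

Definition eigenspace_real A s : set 'cV[R]_m :=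
  [set x | (A - s%:M) *m x = 0].

Definition geneigenspace_real A s : set 'cV[R]_m :=
  [set x | exists2 k : nat, (1 <= k)%N & (A - s%:M) ^+ k *m x = 0].

Definition semisimple A s : Prop :=
  geneigenspace_real A s = eigenspace_real A s.

Definition geneigenspace A mu : set 'cV[R]_m :=
  [set x | exists u : 'cV[R[i]]_m,
     (exists2 k : nat, (1 <= k)%N & (complexify A - mu%:M) ^+ k *m u = 0) /\
     (x = map_mx (@complex.Re R) u \/ x = map_mx (@complex.Im R) u)].

Definition principal_space A : set 'cV[R]_m :=
  geneigenspace_real A (spectral_bound A).

(* The sum over the set of the remaining eigenvalues is a finitely supported
   one, the spectrum being finite. *)
Definition complementary_space A : set 'cV[R]_m :=
  let D := spectrum A `\ (spectral_bound A)%:C in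
  [set x | exists2 f : R[i] -> 'cV[R]_m,
     (forall mu, D mu -> geneigenspace A mu (f mu)) &
     x = \sum_(mu \in D) f mu].

(* For complementary subspaces E1 and E2, the vector x1 in E1 such that
   x - x1 is in E2 exists and is unique. *)
Definition proj_along (E1 E2 : set 'cV[R]_m) x : 'cV[R]_m :=
  xget 0 [set x1 | E1 x1 /\ E2 (x - x1)].

Definition principal_proj A : 'cV[R]_m -> 'cV[R]_m :=
  proj_along (principal_space A) (complementary_space A).

Definition principal_part A (V : 'M[R]_m) : 'M[R]_m :=
  \matrix_(j, i) principal_proj A (col i V) j 0.

End Spectrum.

Section Iteration.
Context {R : realType} {m : nat}.
Implicit Types (A V : 'M[R]_m).

Definition exp_taylor A (n : nat) : 'M[R]_m :=
  \sum_(k < n.+1) (k`!%:R)^-1 *: A ^+ k.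

(* Division by zero yields the zero matrix when T_n M_n(k) = 0, which for
   nonsingular V can only happen if T_n is singular, hence for finitely many n
   since T_n tends to the invertible matrix e^A. *)
Fixpoint normalized_iter A V (n k : nat) : 'M[R]_m :=
  if k is k'.+1 then
    let P := exp_taylor A n *m normalized_iter A V n k' in (normM P)^-1 *: P
  else V.

End Iteration.

(* Main.v *)
(** Write p_n for the n-th Taylor polynomial of exp. On E_1 = E_s the matrix
    T_n^n acts as the scalar p_n(s)^n. If (A - mu)^k u = 0, then in a norm in
    which the nilpotent part A - mu is small, T_n is at most
    exp(Re mu + delta/2) for large n, so that T_n^n u is
    O(exp((s - 3 delta/2) n)) = O(exp(-delta n) p_n(s)^n) when mu <> s. Hence
    T_n^n V / p_n(s)^n = Y + O(exp(-delta n)), and normalizing gives the first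
    estimate. It holds without the second error term because the constants may
    depend on A and V, so o(1) can be taken to be 0. The Rayleigh quotient is
    locally Lipschitz, which gives the second estimate. *)

Require Import Defs.
From HB Require Import structures.
From mathcomp Require Import all_boot all_order all_algebra.
From mathcomp Require Import all_classical all_reals all_analysis.
From mathcomp Require Import complex.
From mathcomp Require Import ring lra.

Set Implicit Arguments.
Unset Strict Implicit.
Unset Printing Implicit Defensive.

Import Order.TTheory GRing.Theory Num.Theory.
Import numFieldNormedType.Exports.

Local Open Scope classical_set_scope.
Local Open Scope complex_scope.
Local Open Scope ring_scope.

(** * Taylor polynomials of the exponential *)

Local Notation normc := ComplexField.Normc.normc.

Lemma normc_ge0 (R : rcfType) (z : R[i]) : 0 <= normc z.
Proof. by case: z => a b; exact: sqrtr_ge0. Qed.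

Lemma normc_real (R : rcfType) (x : R) : normc x%:C = `|x|.
Proof. by rewrite /= expr0n addr0 sqrtr_sqr. Qed.

Definition texp (F : fieldType) (n : nat) (x : F) : F :=
  \sum_(k < n.+1) (k`!%:R)^-1 * x ^+ k.

(** The product sums the terms [t a i * t b j] over the square of indices up to [n]. By the binomial
    theorem [texp n (a + b)] sums the same terms over the triangle [i + j <= n], so the other half
    of the square remains. *)
Lemma texpM_sub (F : numFieldType) n (a b : F) :
  texp n a * texp n b - texp n (a + b) =
  \sum_(0 <= i < n.+1) \sum_(n.+1 - i <= j < n.+1)
    (i`!%:R)^-1 * a ^+ i * ((j`!%:R)^-1 * b ^+ j).
Proof.
pose t (x : F) k := (k`!%:R)^-1 * x ^+ k.
have tD k : t (a + b) k = \sum_(0 <= i < k.+1) t a i * t b (k - i)%N.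
  rewrite /t addrC exprDn mulr_sumr big_mkord; apply: eq_bigr => i _.
  have ik : (i <= k)%N by rewrite -ltnS.
  have fn0 j : (j`!%:R : F) != 0 by rewrite pnatr_eq0 -lt0n fact_gt0.
  have kE : k`!%:R = 'C(k, i)%:R * (i`!%:R * (k - i)`!%:R) :> F.
    by rewrite -!natrM bin_fact.
  have := fn0 k; rewrite kE !mulf_eq0 !negb_or => /and3P[bn0 in0 kin0].
  rewrite -[(_ * _) *+ _]mulr_natr; move: bn0 in0 kin0.
  move: ('C(k, i)%:R) (i`!%:R) ((k - i)`!%:R) (a ^+ i) (b ^+ (k - i)%N).
  by move=> c d e u v c0 d0 e0; field; rewrite c0 d0 e0.
have -> : texp n (a + b) =
    \sum_(0 <= i < n.+1) \sum_(0 <= j < n.+1 - i) t a i * t b j.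
  rewrite /texp -(big_mkord xpredT (t (a + b))).
  under eq_bigr do rewrite tD.
  (* The inner range is widened to a fixed bound with a filter, so that the sums can be exchanged;
     the substitution of [j + i] for [k] then gives the triangle. *)
  under eq_big_nat => k /andP[_ kn].
    rewrite (big_nat_widen _ _ n.+1)//; over.
  rewrite (exchange_big_dep_nat xpredT)//=; apply: eq_big_nat => i /andP[_ lin].
  rewrite [RHS](_ : _ = \sum_(0 + i <= j < n.+1) t a i * t b (j - i)%N); last first.
    by rewrite big_addn; apply: eq_bigr => j _; rewrite addnK.
  rewrite add0n [RHS](big_nat_widenl _ 0)//.
rewrite /texp -!(big_mkord xpredT (t _)) big_distrl -sumrB /=.
apply: eq_big_nat => i /andP[_ lin]; rewrite big_distrr/=.
by rewrite (big_cat_nat (n := n.+1 - i)) ?leq_subr//= addrC addrK.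
Qed.

(** The remainder in [texpM_sub] has nonnegative coefficients, so the triangle inequality bounds it
    by its own value at the moduli. *)
Lemma le_texpM_sub (F : numFieldType) n (a b : F) :
  `|texp n a * texp n b - texp n (a + b)| <=
  texp n `|a| * texp n `|b| - texp n (`|a| + `|b|).
Proof.
rewrite !texpM_sub (le_trans (ler_norm_sum _ _ _))// ler_sum// => i _.
rewrite (le_trans (ler_norm_sum _ _ _))// ler_sum// => j _.
by rewrite !(normrM, normfV, normrX, normr_nat).
Qed.

Lemma cvg_texp (R : realType) (x : R) : texp n x @[n --> \oo] --> expR x.
Proof.
have -> : (fun n => texp n x) = [sequence series (exp_coeff x) n.+1]_n.
  apply/funext => n; rewrite /texp /series/= big_mkord.
  by apply: eq_bigr => k _; rewrite mulrC.
by rewrite cvg_shiftS; exact: is_cvg_series_exp_coeff.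
Qed.

Lemma rmorph_texp (F G : fieldType) (f : {rmorphism F -> G}) n x :
  f (texp n x) = texp n (f x).
Proof.
rewrite rmorph_sum; apply: eq_bigr => k _.
by rewrite rmorphM fmorphV rmorphXn rmorph_nat.
Qed.

(* |p_n(mu)|^2 = p_n(mu) p_n(conj mu) is compared with p_n(2 Re mu). *)
Lemma texp_near_le (R : realType) (mu : R[i]) (eta : R) : 0 < eta ->
  \forall n \near \oo, normc (texp n mu) <= expR (complex.Re mu + eta).
Proof.
move=> eta0; pose x := complex.Re mu; pose a := normc mu.
have normcE z : `|z| = (normc z)%:C :> R[i] by [].
have sq n : normc (texp n mu) ^+ 2 <=
    texp n (x + x) + texp n a * texp n a - texp n (a + a).
  have := le_texpM_sub n mu mu^*.
  rewrite normcJ (_ : mu + mu^* = (x + x)%:C); last first.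
    by rewrite addcJ -/x rmorphD/= mulr2n mulrDl mul1r.
  rewrite -(rmorph_texp (@conjc R)) -sqr_normc !normcE -rmorphXn/=.
  rewrite -rmorphD -!(rmorph_texp (real_complex R)) -rmorphB -rmorphM -rmorphB.
  rewrite /= lecR expr0n/= addr0 sqrtr_sqr => /ler_normlW; lra.
(* The last two terms cancel in the limit, since exp(a)^2 = exp(2a); only exp(2 Re mu) survives. *)
have lim : texp n (x + x) + texp n a * texp n a - texp n (a + a)
    @[n --> \oo] --> expR (x + x).
  rewrite -[expR (x + x)]addr0 -(subrr (expR (a + a))) addrA [X in _ + X - _]expRD.
  by apply: cvgB; [apply: cvgD; [|apply: cvgM]|]; exact: cvg_texp.
near=> n.
rewrite -(ler_pXn2r (n := 2)) ?nnegrE ?expR_ge0 ?normc_ge0//.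
rewrite (le_trans (sq n))// ltW//.
near: n; apply: (cvgr_lt (expR (x + x))) => //.
by rewrite -expRM_natl ltr_expR; lra.
Unshelve. all: by end_near. Qed.

(** * A norm adapted to a nilpotent part *)

Section WeightedNorm.
Context {R : realType} {m : nat}.
Local Notation C := R[i].
Implicit Types (N : 'M[C]_m) (u w : 'cV[C]_m).

Definition l1norm u : R := \sum_i normc (u i 0).

(* In this norm N has norm at most r on the kernel of N^k, for any r > 0. *)
Definition wnorm N (k : nat) (r : R) u : R :=
  \sum_(j < k) r^-1 ^+ j * l1norm (N ^+ j *m u).

Lemma l1norm_ge0 u : 0 <= l1norm u.
Proof. by apply: sumr_ge0 => i _; exact: normc_ge0. Qed.

Lemma l1normD u w : l1norm (u + w) <= l1norm u + l1norm w.
Proof.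
rewrite -big_split/=; apply: ler_sum => i _.
by rewrite mxE le_normcD.
Qed.

Lemma l1normZ c u : l1norm (c *: u) = normc c * l1norm u.
Proof.
by rewrite mulr_sumr; apply: eq_bigr => i _; rewrite mxE ComplexField.Normc.normcM.
Qed.

Lemma l1norm0 : l1norm 0 = 0.
Proof. by rewrite /l1norm big1// => i _; rewrite mxE ComplexField.Normc.normc0. Qed.

Section Fixed.
Variables (N : 'M[C]_m) (k : nat) (r : R).
Hypothesis r_gt0 : 0 < r.
Local Notation S := (wnorm N k r).

Lemma wnorm_ge0 u : 0 <= S u.
Proof.
apply: sumr_ge0 => j _.
by rewrite mulr_ge0 ?l1norm_ge0// exprn_ge0// invr_ge0 ltW.
Qed.

Lemma wnormD u w : S (u + w) <= S u + S w.
Proof.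
rewrite -big_split/=; apply: ler_sum => j _.
by rewrite -mulrDr mulmxDr ler_wpM2l ?l1normD// exprn_ge0// invr_ge0 ltW.
Qed.

Lemma wnormZ c u : S (c *: u) = normc c * S u.
Proof.
by rewrite mulr_sumr; apply: eq_bigr => j _; rewrite -scalemxAr l1normZ mulrCA.
Qed.

Lemma wnorm0 : S 0 = 0.
Proof. by rewrite -[X in S X](scale0r 0) wnormZ ComplexField.Normc.normc0 mul0r. Qed.

Lemma wnorm_sum (I : Type) (s : seq I) (F : I -> 'cV[C]_m) :
  S (\sum_(i <- s) F i) <= \sum_(i <- s) S (F i).
Proof.
elim: s => [|i s ih]; first by rewrite !big_nil wnorm0.
by rewrite !big_cons (le_trans (wnormD _ _))// lerD2l.
Qed.

Lemma l1norm_le_wnorm u : (0 < k)%N -> l1norm u <= S u.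
Proof.
case: k => // k' _; rewrite /wnorm big_ord_recl expr0 mul1r expr0 mul1mx lerDl.
by apply: sumr_ge0 => j _; rewrite mulr_ge0 ?l1norm_ge0// exprn_ge0// invr_ge0 ltW.
Qed.

(** Applying [N] shifts the weighted sum by one index at the price of a factor [r]. The new top term
    vanishes, and the lost term of index 0 is nonnegative. *)
Lemma wnorm_nilpotent u : N ^+ k *m u = 0 -> S (N *m u) <= r * S u.
Proof.
move=> Nku; rewrite -[r]invrK -ler_pdivrMl ?invr_gt0// invrK /wnorm mulr_sumr.
pose F j := r^-1 ^+ j * l1norm (N ^+ j *m u).
have -> : \sum_(j < k) r^-1 * (r^-1 ^+ j * l1norm (N ^+ j *m (N *m u))) =
    \sum_(j < k) F j.+1.
  by apply: eq_bigr => j _; rewrite mulrA -exprS mulmxA mulmxE -exprSr.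
rewrite -(lerD2l (F 0%N)) -(big_ord_recl k (fun j => F j)) big_ord_recr/=.
rewrite {2}/F Nku l1norm0 mulr0 addr0 lerDr /F expr0 mul1r.
exact: l1norm_ge0.
Qed.

Variable mu : C.
Let B := N + mu%:M.

(** In the binomial expansion of (N + mu)^j every term but mu^j contains [N], and each factor [N]
    costs at most [r]. The proof is by induction on [j], since [B] preserves the kernel of
    [N ^+ k]. *)
Lemma wnorm_exprB_sub u j : N ^+ k *m u = 0 ->
  S (B ^+ j *m u - mu ^+ j *: u) <=
  ((normc mu + r) ^+ j - normc mu ^+ j) * S u.
Proof.
move=> Nku; have NB : GRing.comm (N ^+ k) B.
  apply/commr_sym/commrX/commr_sym; apply: commrD => //.
  by rewrite /GRing.comm -!mulmxE scalar_mxC.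
have NkB i : N ^+ k *m (B ^+ i *m u) = 0.
  rewrite mulmxA mulmxE (commrX i NB) -mulmxE -mulmxA Nku mulmx0 //.
elim: j => [|j ih]; first by rewrite !expr0 mul1mx scale1r !subrr mul0r wnorm0.
set D := _ - _ in ih.
have ND : N ^+ k *m D = 0.
  by rewrite mulmxBr NkB -scalemxAr Nku scaler0 subrr.
(* With a = |mu|, the three terms are at most r S(D), a S(D) and a^j r S(u), which matches the
   recurrence of (a + r)^j - a^j. *)
have -> : B ^+ j.+1 *m u - mu ^+ j.+1 *: u =
    N *m D + (mu *: D + mu ^+ j *: (N *m u)).
  rewrite !exprS -mulmxE -mulmxA {1}/B mulmxDl mul_scalar_mx.
  rewrite /D mulmxBr -scalemxAr scalerBr scalerA.
  by rewrite [X in _ = _ + X]addrC addrA subrK addrA.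
have nX i : normc (mu ^+ i) = normc mu ^+ i.
  elim: i => [|i ihi]; first by rewrite !expr0 ComplexField.Normc.normc1.
  by rewrite !exprS ComplexField.Normc.normcM ihi.
rewrite (le_trans (wnormD _ _))//.
rewrite (le_trans (lerD (wnorm_nilpotent ND) (wnormD _ _)))//.
rewrite !wnormZ nX.
have := wnorm_nilpotent Nku; have := normc_ge0 mu; move: (normc mu) ih => a.
move: (S D) (S u) (S (N *m u)) => x y z xy a0 zy.
have := ler_wpM2l (ltW r_gt0) xy; have := ler_wpM2l a0 xy.
have := ler_wpM2l (exprn_ge0 j a0) zy; rewrite !exprS.
move: (a ^+ j) ((a + r) ^+ j) => p q; nra.
Qed.

(** The scalar [texp n mu] is split off before taking norms: bounding term by term would give the
    rate |mu| instead of Re mu. Only the nilpotent correction is estimated through moduli, and it is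
    small with [r]. *)
Lemma wnorm_texp u n : N ^+ k *m u = 0 ->
  S (\sum_(j < n.+1) (j`!%:R)^-1 *: B ^+ j *m u) <=
  (normc (texp n mu) + texp n (normc mu + r) - texp n (normc mu)) * S u.
Proof.
move=> Nku; have -> : \sum_(j < n.+1) (j`!%:R)^-1 *: B ^+ j *m u =
    texp n mu *: u + \sum_(j < n.+1) (j`!%:R)^-1 *: (B ^+ j *m u - mu ^+ j *: u).
  rewrite scaler_suml -big_split/=; apply: eq_bigr => j _.
  by rewrite scalerBr scalerA addrC subrK scalemxAl.
rewrite (le_trans (wnormD _ _))// wnormZ -!addrA mulrDl lerD2l.
rewrite (le_trans (wnorm_sum _ _))// -sumrB mulr_suml; apply: ler_sum => j _.
rewrite wnormZ -mulrBr -mulrA (_ : normc _ = (j`!%:R)^-1); last first.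
  rewrite ComplexField.Normc.normcV -(rmorph_nat (real_complex R)) normc_real.
  by rewrite ger0_norm.
by rewrite ler_wpM2l ?invr_ge0// wnorm_exprB_sub.
Qed.

End Fixed.
End WeightedNorm.

(** * Growth of the iterates on generalized eigenspaces *)

Section Growth.
Context {R : realType} {m : nat}.
Implicit Types (A : 'M[R]_m) (x : 'cV[R]_m).

Definition growth_le A (c : R) x : Prop := exists2 C : R, 0 <= C &
  \forall n \near \oo, forall i,
    `|(exp_taylor A n ^+ n *m x) i 0| <= C * expR (c * n%:R).

Lemma growth_leD A c x y : growth_le A c x -> growth_le A c y ->
  growth_le A c (x + y).
Proof.
move=> [C C0 Cx] [C' C'0 Cy]; exists (C + C'); first exact: addr_ge0.
near=> n => i; rewrite mulmxDr mxE (le_trans (ler_normD _ _))// mulrDl lerD//.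
- by move: i; near: n.
- by move: i; near: n.
Unshelve. all: by end_near. Qed.

Lemma growth_le0 A c : growth_le A c 0.
Proof.
by exists 0 => //; near=> n => i; rewrite mulmx0 mxE normr0 mul0r.
Unshelve. all: by end_near. Qed.

Lemma growth_leZ A c a x : growth_le A c x -> growth_le A c (a *: x).
Proof.
move=> [C C0 Cx]; exists (`|a| * C); first exact: mulr_ge0.
near=> n => i; rewrite -scalemxAr mxE normrM -mulrA ler_wpM2l//.
by move: i; near: n.
Unshelve. all: by end_near. Qed.

Lemma growth_le_mono A c c' x : c <= c' -> growth_le A c x -> growth_le A c' x.
Proof.
move=> cc' [C C0 Cx]; exists C => //; near=> n => i.
rewrite (@le_trans _ _ (C * expR (c * n%:R)))//; first by move: i; near: n.
by rewrite ler_wpM2l// ler_expR ler_wpM2r.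
Unshelve. all: by end_near. Qed.

Lemma complexify_exp_taylor A n : complexify (exp_taylor A n) =
  \sum_(k < n.+1) (k`!%:R)^-1 *: complexify A ^+ k.
Proof.
rewrite /complexify /exp_taylor raddf_sum; apply: eq_bigr => k _.
by rewrite /= map_mxZ fmorphV rmorph_nat rmorphXn.
Qed.

Lemma map_Re_complexifyM A (u : 'cV[R[i]]_m) :
  map_mx (@complex.Re R) (complexify A *m u) = A *m map_mx (@complex.Re R) u.
Proof.
apply/matrixP => i j; rewrite !mxE raddf_sum; apply: eq_bigr => k _.
by rewrite !mxE; case: (u k j) => a b /=; rewrite mul0r subr0.
Qed.

Lemma map_Im_complexifyM A (u : 'cV[R[i]]_m) :
  map_mx (@complex.Im R) (complexify A *m u) = A *m map_mx (@complex.Im R) u.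
Proof.
apply/matrixP => i j; rewrite !mxE raddf_sum; apply: eq_bigr => k _.
by rewrite !mxE; case: (u k j) => a b /=; rewrite mul0r addr0.
Qed.

Lemma wnorm_taylor_near A (mu : R[i]) k (eta : R) : 0 < eta ->
  exists2 r : R, 0 < r & \forall n \near \oo,
    forall u, (complexify A - mu%:M) ^+ k *m u = 0 ->
    wnorm (complexify A - mu%:M) k r (complexify (exp_taylor A n) *m u) <=
    expR (complex.Re mu + eta) * wnorm (complexify A - mu%:M) k r u.
Proof.
move=> eta0; pose a := normc mu; pose x := complex.Re mu.
(* Half of [eta] pays for [texp n mu] itself; [gap] is the room left for the nilpotent
   correction. *)
pose gap := expR (x + eta) - expR (x + eta / 2).
have gap0 : 0 < gap by rewrite subr_gt0 ltr_expR; lra.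
have [r r0 ra] : exists2 r, 0 < r & expR (a + r) < expR a + gap.
  have pos : 0 < expR a + gap / 2 by rewrite addr_gt0 ?expR_gt0 ?divr_gt0.
  (* This [r] solves exp(a + r) = exp(a) + gap / 2. *)
  exists (ln (expR a + gap / 2) - a).
    by rewrite subr_gt0 -[ltLHS]expRK ltr_ln ?posrE ?expR_gt0// ltrDl divr_gt0.
  by rewrite addrC subrK lnK ?posrE//; lra.
exists r => //; near=> n => u Nku.
rewrite complexify_exp_taylor mulmx_suml.
have := @wnorm_texp _ _ _ k r r0 mu u n Nku; rewrite subrK => /le_trans; apply.
rewrite ler_wpM2r ?wnorm_ge0//.
have : normc (texp n mu) <= expR (x + eta / 2).
  by near: n; apply: texp_near_le; rewrite divr_gt0.
have : texp n (a + r) - texp n a < gap.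
  near: n; apply: (cvgr_lt (expR (a + r) - expR a)); last by lra.
  by apply: cvgB; exact: cvg_texp.
rewrite /gap -/a -/x; lra.
Unshelve. all: by end_near. Qed.

(** [T_n] commutes with [N], hence maps the kernel of [N ^+ k] to itself, and the one-step bound in
    [wnorm] can be iterated [n] times. The weighted norm dominates the entries, and so their real
    and imaginary parts. *)
Lemma geneigenspace_growth A mu eta x : 0 < eta -> geneigenspace A mu x ->
  growth_le A (complex.Re mu + eta) x.
Proof.
move=> eta0 [u [[k k1 Nku] xu]].
have [r r0 Tu] := @wnorm_taylor_near A mu k eta eta0.
set N := complexify A - mu%:M in Nku Tu.
exists (wnorm N k r u); first exact: wnorm_ge0.
have NA : GRing.comm (N ^+ k) (complexify A).
  apply/commr_sym/commrX/commrB => //.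
  by rewrite /GRing.comm -!mulmxE scalar_mxC.
near=> n; pose Tn := complexify (exp_taylor A n).
have Tw w : N ^+ k *m w = 0 ->
    wnorm N k r (Tn *m w) <= expR (complex.Re mu + eta) * wnorm N k r w.
  by move: w; rewrite /Tn; near: n.
move=> i; have NT : GRing.comm (N ^+ k) Tn.
  rewrite /Tn complexify_exp_taylor; apply: commr_sum => j _.
  by rewrite /GRing.comm -!mulmxE -scalemxAr -scalemxAl mulmxE (commrX j NA).
have NkT j : N ^+ k *m (Tn ^+ j *m u) = 0.
  by rewrite mulmxA mulmxE (commrX j NT) -mulmxE -mulmxA Nku mulmx0.
have Tj j : wnorm N k r (Tn ^+ j *m u) <=
    expR (complex.Re mu + eta) ^+ j * wnorm N k r u.
  elim: j => [|j ih]; first by rewrite !expr0 mul1mx mul1r.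
  rewrite !exprS -mulmxE -mulmxA -mulrA.
  by rewrite (le_trans (Tw _ (NkT j)))// ler_wpM2l ?expR_ge0.
have entry (w : 'cV[R[i]]_m) : normc (w i 0) <= l1norm w.
  by rewrite /l1norm (bigD1 i)//= lerDl sumr_ge0// => j _; exact: normc_ge0.
have le_normc (z : R[i]) : `|complex.Re z| <= normc z /\ `|complex.Im z| <= normc z.
  case: z => p q /=; rewrite -!sqrtr_sqr !ler_sqrt ?addr_ge0 ?sqr_ge0//.
  by rewrite lerDl lerDr !sqr_ge0.
have TnX : Tn ^+ n = complexify (exp_taylor A n ^+ n).
  by rewrite /Tn /complexify rmorphXn.
apply: (le_trans (y := normc ((Tn ^+ n *m u) i 0))).
  case: xu => ->; rewrite -?map_Re_complexifyM -?map_Im_complexifyM -TnX mxE.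
  - by have [] := le_normc ((Tn ^+ n *m u) i 0).
  - by have [] := le_normc ((Tn ^+ n *m u) i 0).
apply: (le_trans (entry _)); apply: (le_trans (l1norm_le_wnorm N r0 _ k1)).
by rewrite (le_trans (Tj _))// mulrC expRM_natr.
Unshelve. all: by end_near. Qed.

Lemma complementary_space_growth A eta c x : 0 < eta ->
  (forall mu, spectrum A mu -> mu != (spectral_bound A)%:C ->
     complex.Re mu + eta <= c) ->
  complementary_space A x -> growth_le A c x.
Proof.
move=> eta0 specA [f fD ->]; rewrite big_seq.
elim/big_ind: _ => [|y z|mu]; [exact: growth_le0|exact: growth_leD|].
move=> muD.
(* The index lies in the finite support of the sum, a subset of the index set. *)
have [Amu mus] : (spectrum A `\ (spectral_bound A)%:C) mu.
  by move: muD; case: finite_supportP => //= X XD _ _ /XD.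
apply: (growth_le_mono (specA _ Amu _)); first exact/eqP.
by apply: geneigenspace_growth => //; apply: fD.
Qed.

End Growth.

(** * Spectral decomposition *)

Lemma horner_mx_XsubC_exp (F : fieldType) m (B : 'M[F]_m.+1) z k :
  horner_mx B (('X - z%:P) ^+ k) = (B - z%:M) ^+ k.
Proof. by rewrite rmorphXn rmorphB/= horner_mx_X horner_mx_C. Qed.

(** Induction on the roots with a Bezout relation u p + v q = 1 between the first factor p and the
    product q of the others: p(B) kills (v q)(B) x, and q(B) kills (u p)(B) x, which is decomposed
    further. *)
Lemma kernel_prod_XsubC_decomp (F : fieldType) m (B : 'M[F]_m.+1)
    (ds : seq F) (c : F -> nat) (x : 'cV[F]_m.+1) : uniq ds ->
  horner_mx B (\prod_(z <- ds) ('X - z%:P) ^+ c z) *m x = 0 ->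
  exists2 w : F -> 'cV[F]_m.+1, x = \sum_(z <- ds) w z &
    forall z, z \in ds -> (B - z%:M) ^+ c z *m w z = 0.
Proof.
elim: ds x => [|z ds ih] x /=.
  by rewrite !big_nil rmorph1 mul1mx => _ ->; exists (fun=> 0); rewrite ?big_nil.
move=> /andP[zds uds]; rewrite big_cons; set p := _ ^+ _; set q := \prod_(_ <- _) _.
have pq : coprimep p q.
  rewrite /q big_seq; elim/big_ind: _ => [|a b|y yds]; first exact: coprimep1.
    by rewrite coprimepMr => -> ->.
  apply/coprimep_expl/coprimep_expr/coprimep_XsubC2.
  by rewrite subr_eq0; apply: contraNneq zds => <-.
have /Bezout_eq1_coprimepP[[u v] /= uv] := pq => pqx.
have qup : q * (u * p) = u * (p * q) by rewrite mulrC -mulrA.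
have pvq : p * (v * q) = v * (p * q) by rewrite mulrCA.
have kill r s t : r * s = t * (p * q) -> horner_mx B r *m (horner_mx B s *m x) = 0.
  move=> rs; rewrite mulmxA mulmxE -rmorphM rs rmorphM -mulmxE -mulmxA.
  by rewrite pqx mulmx0.
have [w xw kw] := ih _ uds (kill _ _ _ qup).
exists (fun y => if y == z then horner_mx B (v * q) *m x else w y).
  rewrite big_cons eqxx (eq_big_seq w) => [|y yds]; last first.
    by rewrite ifN//; apply: contraNneq zds => <-.
  by rewrite -xw -mulmxDl -rmorphD/= addrC uv rmorph1 mul1mx.
move=> y; rewrite inE; case: eqP => [->|_] /= yds; last exact: kw.
by rewrite -horner_mx_XsubC_exp; exact: kill pvq.
Qed.

Section Decomposition.
Context {R : realType} {m : nat}.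
Implicit Types (A : 'M[R]_m.+1) (x : 'cV[R]_m.+1).

(** By Cayley-Hamilton the kernel decomposition applies to the characteristic polynomial over the
    complex numbers. Real parts of the components of the real vector [x] still sum to [x]. This
    existence makes the [xget] in [proj_along] meaningful. *)
Lemma principal_complementary_decomp A x : perron_like A ->
  exists x1, principal_space A x1 /\ complementary_space A (x - x1).
Proof.
move=> [sA _]; set s := spectral_bound A in sA.
pose Ac := complexify A.
have [rs pE] := closed_field_poly_normal (char_poly Ac).
rewrite (monicP (char_poly_monic _)) scale1r in pE.
have pE' : char_poly Ac =
    \prod_(z <- undup rs) ('X - z%:P) ^+ count_mem z rs.
  by rewrite pE prodr_undup_exp_count.
have spE z : spectrum A z <-> z \in undup rs.
  rewrite /spectrum/= eigenvalue_root_char pE mem_undup -root_prod_XsubC.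
  by split.
have [|w xw kw] := @kernel_prod_XsubC_decomp _ _ Ac (undup rs)
    (fun z => count_mem z rs) (map_mx (real_complex R) x) (undup_uniq _).
  by rewrite -pE' Cayley_Hamilton mul0mx.
pose f z := map_mx (@complex.Re R) (w z).
have xf : x = \sum_(z <- undup rs) f z.
  have -> : x = map_mx (@complex.Re R) (map_mx (real_complex R) x).
    by apply/matrixP => i j; rewrite !mxE.
  rewrite xw; elim: (undup rs) => [|z ds ih].
    by rewrite !big_nil; apply/matrixP => i j; rewrite !mxE.
  rewrite !big_cons -ih; apply/matrixP => i j; rewrite !mxE.
  by case: (w z i j) => a b; case: (_ i j).
have cnt z : z \in undup rs -> (1 <= count_mem z rs)%N.
  by rewrite mem_undup -has_pred1 has_count.
have srs : s%:C \in undup rs by apply/spE.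
exists (f s%:C); split.
  exists (count_mem s%:C rs); first exact: cnt.
  (* Since s is real, (A - s)^k is a real matrix and commutes with taking real parts. *)
  rewrite -map_Re_complexifyM /complexify rmorphXn rmorphB/= map_scalar_mx.
  by rewrite kw//; apply/matrixP => i j; rewrite !mxE.
exists f.
  move=> mu [Amu _]; exists (w mu); split; last by left.
  have /spE murs := Amu.
  by exists (count_mem mu rs); [exact: cnt|exact: kw].
rewrite xf (bigD1_seq s%:C)//= ?undup_uniq// [f _ + _]addrC addrK.
rewrite -big_filter fsbig_seq ?filter_uniq ?undup_uniq//.
apply: eq_fsbigl; apply/seteqP; split => z /=; rewrite mem_filter.
  by move=> /andP[/eqP zs zrs]; split; [exact/spE|exact: zs].
by move=> [/spE zrs zs]; rewrite zrs andbT; apply/eqP.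
Qed.

(** The characteristic polynomial is real, so [s] is a root of it over [R] as well. Passing to the
    transpose turns a row eigenvector into a column one. *)
Lemma real_eigenvector A (s : R) : spectrum A s%:C ->
  exists2 x : 'cV[R]_m.+1, x != 0 & A *m x = s *: x.
Proof.
rewrite /spectrum/= eigenvalue_root_char /complexify -map_char_poly fmorph_root.
have -> : char_poly A = char_poly A^T.
  rewrite /char_poly -det_tr; congr (\det _); apply/matrixP => i j.
  by rewrite !mxE eq_sym.
rewrite -eigenvalue_root_char => /eigenvalueP[v vA v0].
exists v^T; first by rewrite trmx_eq0.
by rewrite -[A]trmxK -trmx_mul vA linearZ.
Qed.

End Decomposition.

(** * Euclidean norm and normalization of matrices *)

Lemma Cauchy_Schwarz_sum (R : realFieldType) (I : finType) (a b : I -> R) :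
  (\sum_i a i * b i) ^+ 2 <= (\sum_i a i ^+ 2) * (\sum_i b i ^+ 2).
Proof.
set X := \sum_i _; set P := \sum_i _; set Q := \sum_i _.
have Q0 : 0 <= Q by apply: sumr_ge0 => i _; exact: sqr_ge0.
have PQX : 0 <= Q * (P * Q - X ^+ 2).
  (* Division-free form of the squared distance from [a] to its projection on [b]; the degenerate
     case [Q = 0] is treated apart. *)
  have <- : \sum_i (Q * a i - X * b i) ^+ 2 = Q * (P * Q - X ^+ 2).
    transitivity (\sum_i (Q ^+ 2 * a i ^+ 2 - (2 * Q * X) * (a i * b i) +
        X ^+ 2 * b i ^+ 2)); first by apply: eq_bigr => i _; ring.
    by rewrite big_split sumrB/= -!mulr_sumr -/X -/P -/Q; ring.
  by apply: sumr_ge0 => i _; exact: sqr_ge0.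
have [Qe|Qn0] := eqVneq Q 0; last first.
  by rewrite pmulr_rge0 ?subr_ge0// in PQX; rewrite lt0r Qn0.
have b0 i : b i = 0.
  apply/eqP; rewrite -sqrf_eq0; move/eqP: Qe.
  rewrite psumr_eq0 => [/allP/(_ i)|j _].
    by rewrite mem_index_enum; exact.
  exact: sqr_ge0.
by rewrite Qe mulr0 /X big1 ?expr0n// => i _; rewrite b0 mulr0.
Qed.

Section MatrixNorm.
Context {R : realType} {m : nat}.
Implicit Types (A M N : 'M[R]_m) (c : R).

Lemma dotM_pair M N :
  dotM M N = \sum_(p : 'I_m * 'I_m) M p.1 p.2 * N p.1 p.2.
Proof.
rewrite /dotM /dotv exchange_big pair_bigA /=.
by apply: eq_bigr => -[i j] _; rewrite !mxE.
Qed.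

Lemma dotMC M N : dotM M N = dotM N M.
Proof. by rewrite !dotM_pair; apply: eq_bigr => p _; rewrite mulrC. Qed.

Lemma dotMDl M M' N : dotM (M + M') N = dotM M N + dotM M' N.
Proof. by rewrite !dotM_pair -big_split; apply: eq_bigr => p _; rewrite mxE mulrDl. Qed.

Lemma dotMZl c M N : dotM (c *: M) N = c * dotM M N.
Proof. by rewrite !dotM_pair mulr_sumr; apply: eq_bigr => p _; rewrite mxE mulrA. Qed.

Lemma dotMDr M N N' : dotM M (N + N') = dotM M N + dotM M N'.
Proof. by rewrite dotMC dotMDl dotMC [dotM N' M]dotMC. Qed.

Lemma dotMBl M M' N : dotM (M - M') N = dotM M N - dotM M' N.
Proof. by rewrite dotMDl -scaleN1r dotMZl mulN1r. Qed.

Lemma dotMBr M N N' : dotM M (N - N') = dotM M N - dotM M N'.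
Proof. by rewrite dotMC dotMBl dotMC [dotM N' M]dotMC. Qed.

Lemma dotM_sq M : dotM M M = \sum_(p : 'I_m * 'I_m) M p.1 p.2 ^+ 2.
Proof. by rewrite dotM_pair; apply: eq_bigr => p _; rewrite expr2. Qed.

Lemma dotM_ge0 M : 0 <= dotM M M.
Proof. by rewrite dotM_sq sumr_ge0// => p _; exact: sqr_ge0. Qed.

Lemma normM_ge0 M : 0 <= normM M.
Proof. exact: sqrtr_ge0. Qed.

Lemma sqr_normM M : normM M ^+ 2 = dotM M M.
Proof. by rewrite sqr_sqrtr// dotM_ge0. Qed.

Lemma normM_eq0 M : (normM M == 0) = (M == 0).
Proof.
rewrite -sqrf_eq0 sqr_normM; apply/eqP/eqP => [|->]; last first.
  by rewrite -(scale0r 0) dotMZl mul0r.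
rewrite dotM_sq => /eqP; rewrite psumr_eq0 => [/allP M0|p _]; last exact: sqr_ge0.
apply/matrixP => i j; rewrite mxE; apply/eqP; rewrite -sqrf_eq0.
by have := M0 (i, j); rewrite mem_index_enum; exact.
Qed.

Lemma normM_gt0 M : (0 < normM M) = (M != 0).
Proof. by rewrite lt0r normM_eq0 normM_ge0 andbT. Qed.

Lemma ler_dotM M N : `|dotM M N| <= normM M * normM N.
Proof.
rewrite -sqrtrM ?dotM_ge0// -sqrtr_sqr ler_sqrt ?mulr_ge0 ?dotM_ge0//.
by rewrite !dotM_sq dotM_pair Cauchy_Schwarz_sum.
Qed.

Lemma normMZ c M : normM (c *: M) = `|c| * normM M.
Proof.
by rewrite /normM dotMZl dotMC dotMZl mulrA -expr2 sqrtrM ?sqr_ge0// sqrtr_sqr.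
Qed.

Lemma normMN M : normM (- M) = normM M.
Proof. by rewrite -scaleN1r normMZ normrN1 mul1r. Qed.

Lemma ler_normMD M N : normM (M + N) <= normM M + normM N.
Proof.
rewrite -(ler_pXn2r (n := 2)) ?nnegrE ?addr_ge0 ?normM_ge0//.
rewrite sqrrD !sqr_normM dotMDl !dotMDr [dotM N M]dotMC.
have := ler_norm (dotM M N); have := ler_dotM M N; lra.
Qed.

Lemma ler_normMB M N : normM (M - N) <= normM M + normM N.
Proof. by rewrite (le_trans (ler_normMD _ _))// normMN. Qed.

Lemma ler_distM M N : `|normM M - normM N| <= normM (M - N).
Proof.
have := ler_normMD (M - N) N; have := ler_normMD (N - M) M.
rewrite !subrK -[normM (N - M)]normMN opprB => NM MN; rewrite ler_norml; lra.
Qed.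

Lemma ler_normM_mulmx A M : normM (A *m M) <= normM A * normM M.
Proof.
rewrite -sqrtrM ?dotM_ge0// ler_sqrt ?mulr_ge0 ?dotM_ge0// !dotM_sq.
have pairE N : \sum_(p : 'I_m * 'I_m) N p.1 p.2 ^+ 2 = \sum_i \sum_j N i j ^+ 2.
  by rewrite pair_bigA.
rewrite !pairE [X in _ * X]exchange_big mulr_suml; apply: ler_sum => i _ /=.
rewrite mulr_sumr; apply: ler_sum => j _; rewrite mxE.
exact: Cauchy_Schwarz_sum.
Qed.

Lemma normM_le_entries M (e : R) : 0 <= e -> (forall i j, `|M i j| <= e) ->
  normM M <= m%:R * e.
Proof.
move=> e0 Me; rewrite -[leRHS]ger0_norm ?mulr_ge0// -sqrtr_sqr ler_sqrt ?sqr_ge0//.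
rewrite dotM_sq (@le_trans _ _ (\sum_(p : 'I_m * 'I_m) e ^+ 2))//.
  by apply: ler_sum => p _; rewrite -real_normK ?num_real// lerXn2r ?nnegrE.
by rewrite sumr_const card_prod card_ord -[leLHS]mulr_natl natrM exprMn expr2.
Qed.

(** The zero matrix is sent to itself, which agrees with the convention in [normalized_iter]. *)
Definition normalize M : 'M[R]_m := (normM M)^-1 *: M.

Lemma scale_normalize M : normM M *: normalize M = M.
Proof.
have [->|M0] := eqVneq M 0; first by rewrite /normalize !scaler0.
by rewrite /normalize scalerA mulfV ?scale1r// normM_eq0.
Qed.

Lemma normM_normalize M : M != 0 -> normM (normalize M) = 1.
Proof.
move=> M0; rewrite normMZ ger0_norm ?invr_ge0 ?normM_ge0// mulVf//.
by rewrite normM_eq0.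
Qed.

Lemma normM_normalize_le1 M : normM (normalize M) <= 1.
Proof.
have [->|M0] := eqVneq M 0; last by rewrite normM_normalize.
by rewrite /normalize scaler0 (eqP (_ : normM 0 == 0)) ?normM_eq0.
Qed.

Lemma normalizeZ c M : 0 < c -> normalize (c *: M) = normalize M.
Proof.
move=> c0; rewrite /normalize normMZ gtr0_norm// scalerA invfM mulrAC mulVf ?mul1r//.
exact: lt0r_neq0.
Qed.

Lemma normalize_dist M N : N != 0 ->
  normM (normalize M - normalize N) <= 2 / normM N * normM (M - N).
Proof.
move=> N0; have N_gt0 : 0 < normM N by rewrite normM_gt0.
rewrite -mulrA mulrCA ler_pdivlMl//.
rewrite -{1}[normM N]ger0_norm ?normM_ge0// -normMZ scalerBr scale_normalize.
(* Both terms on the right have norm at most [normM (M - N)], the first by the reverse triangle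
   inequality; this is the origin of the factor 2. *)
have -> : normM N *: normalize M - N =
    (normM N - normM M) *: normalize M + (M - N).
  by rewrite scalerBl scale_normalize addrA subrK.
rewrite (le_trans (ler_normMD _ _))// normMZ mulr_natl mulr2n lerD2r.
rewrite -[leRHS]mulr1 ler_pM ?normM_ge0 ?normM_normalize_le1//.
by rewrite distrC ler_distM.
Qed.

(** Normalization ignores positive factors, so normalizing at each step or once at the end is the
    same. If some iterate vanishes, both sides are 0 from then on. *)
Lemma normalized_iterE A V n k : normM V = 1 ->
  normalized_iter A V n k = normalize (exp_taylor A n ^+ k *m V).
Proof.
move=> V1; elim: k => [|k ih] /=.
  by rewrite expr0 mul1mx /normalize V1 invr1 scale1r.
rewrite -/(normalize _) ih exprS -mulmxE -mulmxA.
set M := _ ^+ k *m V.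
have [->|M0] := eqVneq M 0; first by rewrite /normalize !(scaler0, mulmx0).
by rewrite [normalize M]/normalize -scalemxAr normalizeZ// invr_gt0 normM_gt0.
Qed.

End MatrixNorm.

(** * Convergence of the normalized iterates *)

Lemma mulmx_col (R : pzSemiRingType) m n p (M : 'M[R]_(m, n)) (N : 'M[R]_(n, p)) j :
  M *m col j N = col j (M *m N).
Proof. by apply/matrixP => i k; rewrite !mxE; apply: eq_bigr => l _; rewrite mxE. Qed.

Lemma expRN_cvg0 (R : realType) (delta : R) : 0 < delta ->
  expR (- delta * n%:R) @[n --> \oo] --> (0 : R).
Proof.
move=> d0; rewrite (_ : (fun n => _) = (fun n => expR (- delta) ^+ n)); last first.
  by apply/funext => n; rewrite expRM_natr.
by apply: cvg_expr; rewrite ger0_norm ?expR_ge0// expR_lt1 oppr_lt0.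
Qed.

(** For the finitely many [n < N] the bound 2 is absorbed by the constant 2 exp(delta N). *)
Lemma near_bound_all (R : realType) (delta C : R) (a : nat -> R) : 0 < delta ->
  0 <= C -> (forall n, a n <= 2) ->
  (\forall n \near \oo, a n <= C * expR (- delta * n%:R)) ->
  exists2 B, 0 < B & forall n, a n <= B * expR (- delta * n%:R).
Proof.
move=> d0 C0 a2 [N _ aN]; exists (C + 2 * expR (delta * N%:R)).
  by rewrite ltr_wpDl// mulr_gt0// expR_gt0.
move=> n; have [nN|Nn] := leqP N n.
  rewrite (le_trans (aN _ nN))// ler_wpM2r ?expR_ge0//.
  by rewrite lerDl mulr_ge0// expR_ge0.
rewrite (le_trans (a2 n))// mulrDl -mulrA -expRD.
rewrite (@le_trans _ _ (2 * expR (delta * N%:R + - delta * n%:R)))//.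
  rewrite ler_peMr// -[leLHS]expR0 ler_expR mulNr -mulrBr.
  by rewrite mulr_ge0 ?(ltW d0)// subr_ge0 ler_nat ltnW.
by rewrite lerDr mulr_ge0// expR_ge0.
Qed.

Section PowerMethod.
Context {R : realType} {m : nat}.
Variables (A : 'M[R]_m.+1) (delta : R) (V : 'M[R]_m.+1).
Let s := spectral_bound A.
Let Y := principal_part A V.
Hypothesis perronA : perron_like A.
Hypothesis delta_gt0 : 0 < delta.
Hypothesis gapA : forall mu, spectrum A mu -> mu != s%:C ->
  complex.Re mu <= s - 2 * delta.
Hypothesis semisimpleA : semisimple A s.
Hypothesis unitV : V \in unitmx.

(** An upper rate on E_2: the gap 2 delta less a loss of delta/2 in the growth estimate. The other
    delta/2 is spent on the lower bound exp(s - delta/2) of [texp n s], leaving the ratio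
    exp(-delta). *)
Let c := s - delta * (3 / 2).

(** Semisimplicity makes the component in E_1 a true eigenvector; the other component lies in E_2
    and has the growth bound there. *)
Lemma principal_partP j : A *m col j Y = s *: col j Y /\
  growth_le A c (col j V - col j Y).
Proof.
have -> : col j Y = principal_proj A (col j V).
  by apply/matrixP => i k; rewrite !mxE ord1.
have [x1 x1P] := principal_complementary_decomp (col j V) perronA.
have [pY cY] : [set x1 | principal_space A x1 /\
    complementary_space A (col j V - x1)] (principal_proj A (col j V)).
  exact: (xgetI _ x1P).
split.
  have : eigenspace_real A s (principal_proj A (col j V)) by rewrite -semisimpleA.
  rewrite /eigenspace_real/= mulmxBl mul_scalar_mx => /eqP.
  by rewrite subr_eq0 => /eqP.
apply: complementary_space_growth cY; first exact: (divr_gt0 delta_gt0 (ltr0n _ 2)).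
by move=> mu Amu mus; have := gapA Amu mus; rewrite /c; lra.
Qed.

Lemma exp_taylor_eigenvector n k (x : 'cV[R]_m.+1) : A *m x = s *: x ->
  exp_taylor A n ^+ k *m x = texp n s ^+ k *: x.
Proof.
move=> Ax.
have AX j : A ^+ j *m x = s ^+ j *: x.
  elim: j => [|j ih]; first by rewrite !expr0 mul1mx scale1r.
  by rewrite exprSr -mulmxE -mulmxA Ax -scalemxAr ih scalerA -exprS.
have Tx : exp_taylor A n *m x = texp n s *: x.
  rewrite mulmx_suml scaler_suml; apply: eq_bigr => j _.
  by rewrite -scalemxAl AX scalerA.
elim: k => [|k ih]; first by rewrite !expr0 mul1mx scale1r.
by rewrite exprSr -mulmxE -mulmxA Tx -scalemxAr ih scalerA -exprS.
Qed.

Lemma texp_near_ge : \forall n \near \oo, expR (s - delta / 2) <= texp n s.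
Proof.
near=> n; apply: ltW; near: n; apply: (cvgr_gt (expR s)); first exact: cvg_texp.
by rewrite ltr_expR; have := delta_gt0; lra.
Unshelve. all: by end_near. Qed.

Lemma growth_le_texp n : expR (s - delta / 2) <= texp n s ->
  expR (c * n%:R) <= expR (- delta * n%:R) * texp n s ^+ n.
Proof.
move=> Ts; rewrite (_ : c * n%:R = - delta * n%:R + (s - delta / 2) * n%:R).
  rewrite expRD ler_wpM2l ?expR_ge0// expRM_natr lerXn2r ?nnegrE ?expR_ge0//.
  exact: le_trans Ts; exact: expR_ge0.
by rewrite /c; lra.
Qed.

(* An eigenvector for s grows like p_n(s)^n, too fast for the span of the
   columns of V when all of them lie in E_2. *)
Lemma principal_part_neq0 : Y != 0.
Proof.
apply/eqP => Y0; have [sA _] := perronA.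
have [x x0 Ax] := real_eigenvector sA.
have : growth_le A c x.
  have -> : x = \sum_j (invmx V *m x) j 0 *: col j V.
    rewrite -{1}[x](mulKVmx unitV); apply/matrixP => i k.
    rewrite ord1 !mxE summxE; apply: eq_bigr => j _.
    by rewrite !mxE mulrC.
  apply: big_ind; [exact: growth_le0|exact: growth_leD|move=> j _].
  apply: growth_leZ; have [_] := principal_partP j.
  by rewrite Y0 (_ : col j 0 = 0) ?subr0//; apply/matrixP => i k; rewrite !mxE.
move=> [C C0 xC]; have [i xi] : exists i, x i 0 != 0.
  apply/existsP; apply: contraNT x0 => /existsPn xz.
  by apply/eqP/matrixP => i k; rewrite ord1 mxE; have := xz i; rewrite negbK => /eqP.
(* Dividing by [texp n s ^+ n], the factor by which [x] is multiplied, leaves a bound that tends to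
   0. *)
have bnd : \forall n \near \oo, `|x i 0| <= C * expR (- delta * n%:R).
  near=> n.
  have Ts : expR (s - delta / 2) <= texp n s by near: n; exact: texp_near_ge.
  have T0 : 0 < texp n s ^+ n by rewrite exprn_gt0// (lt_le_trans _ Ts)// expR_gt0.
  have : `|(exp_taylor A n ^+ n *m x) i 0| <= C * expR (c * n%:R).
    by move: i {xi}; near: n.
  rewrite exp_taylor_eigenvector// mxE normrM gtr0_norm// => xT.
  rewrite -(ler_pM2l T0) (le_trans xT)// mulrCA ler_wpM2l// [leRHS]mulrC.
  exact: growth_le_texp.
have : C * expR (- delta * n%:R) @[n --> \oo] --> C * 0.
  by apply: cvgMr; exact: expRN_cvg0.
rewrite mulr0 => lim0.
have : `|x i 0| <= 0.
  rewrite -(cvg_lim _ lim0)//; apply: limr_ge; last exact: bnd.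
  by apply/cvg_ex; exists 0.
by rewrite normr_le0 (negPf xi).
Unshelve. all: by end_near. Qed.

Lemma iterate_near : exists2 C : R, 0 <= C & \forall n \near \oo,
  normM (normalize (exp_taylor A n ^+ n *m V) - normalize Y) <=
    C * expR (- delta * n%:R).
Proof.
have /choice[C CP] j : exists C : R, 0 <= C /\ \forall n \near \oo, forall i,
    `|(exp_taylor A n ^+ n *m (col j V - col j Y)) i 0| <= C * expR (c * n%:R).
  by have [_ [C C0 CP]] := principal_partP j; exists C.
pose D := \sum_j C j.
have D0 : 0 <= D by apply: sumr_ge0 => j _; have [] := CP j.
have CD j : C j <= D.
  by rewrite /D (bigD1 j)//= lerDl sumr_ge0// => k _; have [] := CP k.
exists (2 / normM Y * (m.+1%:R * D)).
  by rewrite !mulr_ge0// ?invr_ge0 ?normM_ge0.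
near=> n.
have Ts : expR (s - delta / 2) <= texp n s by near: n; exact: texp_near_ge.
set t := texp n s ^+ n.
have t0 : 0 < t by rewrite exprn_gt0// (lt_le_trans _ Ts)// expR_gt0.
set T := exp_taylor A n ^+ n.
have TZ i j : `|(T *m (col j V - col j Y)) i 0| <= D * expR (c * n%:R).
  apply: (le_trans (y := C j * expR (c * n%:R))); last by rewrite ler_wpM2r ?expR_ge0.
  by move: j i; rewrite /T; near: n; apply: filter_forall => j; have [] := CP j.
(* After rescaling by 1/t the matrix is close to [Y] itself: T y_j = t y_j, so the columns of T V /
   t - Y are T (v_j - y_j) / t. *)
rewrite -(normalizeZ _ (c := t^-1)) ?invr_gt0//.
rewrite (le_trans (normalize_dist _ principal_part_neq0))// -[leRHS]mulrA.
rewrite ler_wpM2l ?mulr_ge0 ?invr_ge0 ?normM_ge0// -[leRHS]mulrA.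
apply: normM_le_entries; first by rewrite mulr_ge0 ?expR_ge0.
move=> i j.
have -> : (t^-1 *: (T *m V) - Y) i j = t^-1 * (T *m (col j V - col j Y)) i 0.
  have [AY _] := principal_partP j.
  by rewrite mulmxBr (exp_taylor_eigenvector n n AY) mulmx_col
    !mxE mulrBr mulKf ?gt_eqF.
rewrite normrM gtr0_norm ?invr_gt0// ler_pdivrMl//.
rewrite (le_trans (TZ i j))// mulrCA ler_wpM2l// [leRHS]mulrC.
exact: growth_le_texp.
Unshelve. all: by end_near. Qed.

Lemma iterate_bound : exists2 B : R, 0 < B & forall n,
  normM (normalize (exp_taylor A n ^+ n *m V) - normalize Y) <=
    B * expR (- delta * n%:R).
Proof.
have [C C0 CP] := iterate_near; apply: near_bound_all CP => // n.
rewrite (le_trans (ler_normMB _ _))//.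
by rewrite -[2]/(1 + 1) lerD// normM_normalize_le1.
Qed.

Lemma rayleigh_dist (W : 'M[R]_m.+1) : normM W <= 1 ->
  `|dotM (A *m W) W - s| <= (normM A + `|s|) * normM (W - normalize Y).
Proof.
move=> W1; set U := normalize Y.
have U1 : normM U = 1 by rewrite normM_normalize// principal_part_neq0.
have AY : A *m Y = s *: Y.
  apply/matrixP => i j; have [/matrixP/(_ i 0) + _] := principal_partP j.
  by rewrite mulmx_col !mxE.
have AU : A *m U = s *: U by rewrite -scalemxAr AY scalerA mulrC -scalerA.
(* From A U = s U and |U| = 1, by inserting the mixed term s <U, W>; each summand is then linear in
   W - U. *)
have -> : dotM (A *m W) W - s =
    dotM (A *m (W - U)) W + s * dotM U (W - U).
  rewrite mulmxBr dotMBl AU dotMZl dotMBr -(sqr_normM U) U1; ring.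
rewrite (le_trans (ler_normD _ _))// mulrDl lerD//.
  rewrite (le_trans (ler_dotM _ _))// -[leRHS]mulr1.
  by rewrite ler_pM ?normM_ge0// ler_normM_mulmx.
by rewrite normrM ler_wpM2l// (le_trans (ler_dotM _ _))// U1 mul1r.
Qed.

End PowerMethod.

Theorem theorem5p2 (R : realType) :
  exists2 o1 : nat -> R, o1 n @[n --> \oo] --> (0 : R) &
  forall (m : nat) (A : 'M[R]_m) (delta : R) (V : 'M[R]_m),
    perron_like A ->
    0 < delta ->
    (forall mu : R[i], spectrum A mu -> mu != (spectral_bound A)%:C ->
       complex.Re mu <= spectral_bound A - 2 * delta) ->
    V \in unitmx ->
    normM V = 1 ->
    semisimple A (spectral_bound A) ->
    let s := spectral_bound A in
    let W n := normalized_iter A V n n in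
    let lambda := 2 * expR (2 * normM A) in
    let Y := principal_part A V in
    exists B1 B2 : R, [/\ 0 < B1, 0 < B2,
      forall n : nat,
        normM (W n - (normM Y)^-1 *: Y) <=
          B1 * expR (- delta * n%:R)
          + (lambda * normM A / n.+1%:R) ^+ n.+1 * o1 n &
      forall n : nat,
        `|dotM (A *m W n) (W n) - s| <=
          B2 * expR (- delta * n%:R)
          + normM A * (lambda * normM A / n.+1%:R) ^+ n.+1 * o1 n].
Proof.
exists (fun=> 0); first exact: cvg_cst.
case=> [|m] A delta V perronA d0 gapA unitV V1 ssA s W lambda Y.
  (* In dimension 0 there is no nonzero eigenvector, so no matrix is Perron-like. *)
  have [/eigenvalueP[v _ v0] _] := perronA; case/eqP: v0.
  by apply/matrixP => i [].
have [B B0 BW] := iterate_bound perronA d0 gapA ssA unitV.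
have WE n : W n = normalize (exp_taylor A n ^+ n *m V) by exact: normalized_iterE.
(* The added 1 keeps the second constant positive when [A] is zero. *)
have K0 : 0 < normM A + `|s| + 1 by rewrite ltr_wpDl// addr_ge0 ?normM_ge0.
exists B, ((normM A + `|s| + 1) * B); split => //; first exact: mulr_gt0.
  by move=> n; rewrite mulr0 addr0 WE; exact: BW.
move=> n; rewrite mulr0 addr0 WE.
rewrite (le_trans (rayleigh_dist perronA d0 gapA ssA unitV (normM_normalize_le1 _)))//.
rewrite -mulrA; apply: ler_pM (BW n); rewrite ?normM_ge0 ?lerDl//.
by rewrite addr_ge0 ?normM_ge0.
Qed.
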